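(* Let $B$ be an annihilator nilpotent skew brace. If $B$ is finitely generated as a skew brace, then $B$ satisfies the ascending chain condition on sub skew braces.
   Context: A skew brace is a triple $(B,+,\circ)$ where $(B,+)$ and $(B,\circ)$ are (not necessarily abelian) groups such that $a\circ(b+c)=a\circ b-a+a\circ c$ for all $a,b,c\in B$. The two groups share the same identity, denoted $0$. Put $\lambda_a(b)=-a+a\circ b$. A sub skew brace is a subset that is a subgroup of both $(B,+)$ and $(B,\circ)$; $B$ is finitely generated as a skew brace if some finite subset is contained in no proper sub skew brace. An ideal of $B$ is a subset that is a normal subgroup of both $(B,+)$ and $(B,\circ)$ and is mapped into itself by every $\lambda_a$. The annihilator is $\operatorname{Ann}(B)=\{x\in B: x\circ a=a\circ x=x+a=a+x \text{ for all } a\in B\}$, an ideal of $B$. An annihilator series of $B$ is a series of ideals $0=I_0\subseteq I_1\subseteq\cdots\subseteq I_n=B$ with $I_{j+1}/I_j\subseteq\operatorname{Ann}(B/I_j)$ for $0\le j<n$; $B$ is annihilator nilpotent if it has an annihilator series. *)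

(* Defs.v *)
From HB Require Import structures.
From mathcomp Require Import all_boot.
From mathcomp Require Import boolp classical_sets cardinality.

Set Implicit Arguments.
Unset Strict Implicit.
Unset Printing Implicit Defensive.

Local Open Scope classical_set_scope.
Local Open Scope quotient_scope.

(* (B, o) is the MathComp multiplicative group structure of B, so that a o b
   is written a * b.  MathComp's additive groups are all commutative, hence
   (B, +) is given by the operations and axioms of the mixin. *)
HB.mixin Record isSkewBrace B of Group B := {
  sbadd : B -> B -> B;
  sbzero : B;
  sbopp : B -> B;
  sbaddA : associative sbadd;
  sbadd0l : left_id sbzero sbadd;
  sbaddNl : left_inverse sbzero sbopp sbadd;
  skew_distr : forall a b c : B,
    (a * sbadd b c)%g = sbadd (sbadd (a * b)%g (sbopp a)) (a * c)%g
}.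

#[short(type="skewBraceType")]
HB.structure Definition SkewBrace := {B of isSkewBrace B & Group B}.

Declare Scope brace_scope.
Delimit Scope brace_scope with B.
Bind Scope brace_scope with SkewBrace.sort.
Notation "+%B" := (@sbadd _) (at level 0) : brace_scope.
Notation "-%B" := (@sbopp _) (at level 0) : brace_scope.
Notation "0" := (@sbzero _) : brace_scope.
Notation "x + y" := (sbadd x y) : brace_scope.
Notation "- x" := (sbopp x) : brace_scope.
Notation "x - y" := (sbadd x (sbopp y)) : brace_scope.
Notation "1" := (1%g) : brace_scope.
Notation "x * y" := (x * y)%g : brace_scope.
Notation "x ^-1" := (x^-1)%g : brace_scope.
Local Open Scope brace_scope.

Section SkewBraceTheory.
Variable B : skewBraceType.
Implicit Types a b c x y : B.

Lemma sbaddNr : right_inverse (0 : B) -%B +%B.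
Proof.
move=> x; rewrite -[LHS]sbadd0l -{1}(sbaddNl (- x)) -sbaddA.
by rewrite (sbaddA (- x)) sbaddNl sbadd0l sbaddNl.
Qed.

Lemma sbadd0r : right_id (0 : B) +%B.
Proof. by move=> x; rewrite -(sbaddNl x) sbaddA sbaddNr sbadd0l. Qed.

End SkewBraceTheory.

(* The group (B, +) in multiplicative form, giving access to the theory of
   groupType; x * y in it is convertible to x + y in B. *)
Definition add_group (B : Type) : Type := B.
HB.instance Definition _ (B : skewBraceType) := Choice.on (add_group B).
HB.instance Definition _ (B : skewBraceType) :=
  isGroup.Build (add_group B) (@sbaddA B) (@sbadd0l B) (@sbadd0r B)
    (@sbaddNl B) (@sbaddNr B).

Lemma sboppD (B : skewBraceType) (x y : B) : - (x + y) = - y - x.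
Proof. exact: (@invgM (add_group B)). Qed.

Lemma sboppK (B : skewBraceType) (x : B) : - - x = x.
Proof. exact: (@invgK (add_group B)). Qed.

Section SkewBraceDefs.
Variable B : skewBraceType.
Implicit Types (A I S : set B) (a b x y : B).

Definition lambda a b : B := - a + a * b.

Definition add_subgroup A :=
  [/\ A 0, forall x y, A x -> A y -> A (x + y) & forall x, A x -> A (- x)].

Definition circ_subgroup A :=
  [/\ A 1, forall x y, A x -> A y -> A (x * y)
    & forall x, A x -> A x^-1].

Definition add_normal_subgroup A :=
  add_subgroup A /\ forall a x, A x -> A (a + x - a).

Definition circ_normal_subgroup A :=
  circ_subgroup A /\ forall a x, A x -> A (a * x * a^-1).

Definition sub_skew_brace A := add_subgroup A /\ circ_subgroup A.

Definition is_ideal I :=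
  [/\ add_normal_subgroup I, circ_normal_subgroup I
    & forall a x, I x -> I (lambda a x)].

Definition Ann : set B :=
  [set x | forall a, [/\ x * a = a * x, a * x = x + a & x + a = a + x]].

Definition finitely_generated :=
  exists S : set B, finite_set S /\
    ~ exists A : set B, [/\ sub_skew_brace A, A `<` [set: B] & S `<=` A].

End SkewBraceDefs.

Arguments Ann : clear implicits.
Arguments finitely_generated : clear implicits.

Structure ideal (B : skewBraceType) := Ideal {
  ideal_set :> set B;
  idealP : is_ideal ideal_set
}.

Section Quotient.
Variables (B : skewBraceType) (I : ideal B).
Implicit Types a b c x y : B.

Let G := add_group B.

(* The left cosets x + I and x o I of an ideal coincide (ideal_congE). *)
Definition ideal_cong : rel B := fun x y => `[< ideal_set I (- x + y) >].

Lemma lambdaD a b c : lambda a (b + c) = lambda a b + lambda a c.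
Proof. by rewrite /lambda skew_distr !sbaddA. Qed.

Lemma circE a b : a * b = a + lambda a b.
Proof. exact/esym/(mulVKg (a : G)). Qed.

Lemma lambda_circ a b c : lambda (a * b) c = lambda a (lambda b c).
Proof.
have e : a * b * c = a * b + lambda a (lambda b c).
  rewrite -mulgA [in LHS]circE [b * c in LHS]circE lambdaD sbaddA.
  by rewrite -circE.
rewrite {1}/lambda e; exact: (mulKg ((a * b) : G)).
Qed.

(* The two groups have the same identity. *)
Lemma circ1E : 1 = 0 :> B.
Proof.
have h := skew_distr (1 : B) (0 : B) 0; rewrite !mul1g sbadd0l in h.
have {h} : sbopp 1 + 0 = 0 :> B.
  by rewrite [RHS]h sbadd0l.
by rewrite sbadd0r => h; rewrite -[LHS]sbadd0r -h sbaddNr.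
Qed.

Lemma lambda1 b : lambda 1 b = b.
Proof.
by rewrite /lambda mul1g circ1E -[- 0]sbadd0r sbaddNl sbadd0l.
Qed.

Lemma ideal_congE x y : ideal_cong x y = `[< ideal_set I (x^-1 * y) >].
Proof.
have [_ _ Il] := idealP I.
have e : lambda x (x^-1 * y) = - x + y by rewrite /lambda mulVKg.
apply/asbool_equiv_eq; split; last by move/(Il x); rewrite e.
by move/(Il x^-1); rewrite -e -lambda_circ mulVg lambda1.
Qed.

Lemma ideal_cong_is_equiv : equiv_class_of ideal_cong.
Proof.
have [[[I0 ID IN] _] _ _] := idealP I.
split=> [x|x y|y x z].
- by apply/asboolP; rewrite sbaddNl.
- have h u v : ideal_cong u v -> ideal_cong v u.
    move=> /asboolP/IN H; apply/asboolP; move: H.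
    by rewrite sboppD sboppK.
  by apply/idP/idP; exact: h.
move=> /asboolP h1 /asboolP h2; apply/asboolP.
by have := ID _ _ h1 h2; rewrite -sbaddA (sbaddA y) sbaddNr sbadd0l.
Qed.

Canonical ideal_equiv := EquivRelPack ideal_cong_is_equiv.

Definition quotient := {eq_quot ideal_equiv}.
HB.instance Definition _ := Choice.on quotient.
HB.instance Definition _ := EqQuotient.on quotient.

Lemma quotientP x y : reflect (\pi_quotient x = \pi_quotient y)
  `[< ideal_set I (- x + y) >].
Proof. exact: (@eqquotP _ ideal_cong quotient). Qed.

Lemma quotient_circP x y : reflect (\pi_quotient x = \pi_quotient y)
  `[< ideal_set I (x^-1 * y) >].
Proof. by rewrite -ideal_congE; exact: quotientP. Qed.

Definition qadd (u v : quotient) : quotient := \pi_quotient (repr u + repr v).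
Definition qopp (u : quotient) : quotient := \pi_quotient (- repr u).
Definition qmul (u v : quotient) : quotient := \pi_quotient (repr u * repr v).
Definition qinv (u : quotient) : quotient := \pi_quotient ((repr u)^-1).

Lemma pi_repr x : \pi_quotient x = \pi_quotient (repr (\pi_quotient x)).
Proof. by rewrite reprK. Qed.

Lemma pi_add x y : \pi_quotient (x + y) = qadd (\pi_quotient x) (\pi_quotient y).
Proof.
rewrite /qadd /qopp; have [[[I0 ID IN] In] _ _] := idealP I.
have /quotientP/asboolP hx := pi_repr x.
have /quotientP/asboolP hy := pi_repr y.
move: (repr (\pi_quotient x)) (repr (\pi_quotient y)) hx hy => x' y' hx hy.
apply/quotientP/asboolP.
have := ID _ _ (In (- y) _ hx) hy.
rewrite sboppD sboppK !sbaddA.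
by rewrite -(sbaddA _ y (- y)) sbaddNr sbadd0r.
Qed.

Lemma pi_opp x : \pi_quotient (- x) = qopp (\pi_quotient x).
Proof.
rewrite /qadd /qopp; have [[[I0 ID IN] In] _ _] := idealP I.
have /quotientP/asboolP hx := pi_repr x.
move: (repr (\pi_quotient x)) hx => x' hx.
apply/quotientP/asboolP.
have := In x _ (IN _ hx).
rewrite sboppD sboppK !sbaddA.
by rewrite -(sbaddA _ x (- x)) sbaddNr sbadd0r.
Qed.

Lemma pi_mul x y : \pi_quotient (x * y) = qmul (\pi_quotient x) (\pi_quotient y).
Proof.
rewrite /qmul /qinv; have [_ [[I0 ID IN] In] _] := idealP I.
have /quotient_circP/asboolP hx := pi_repr x.
have /quotient_circP/asboolP hy := pi_repr y.
move: (repr (\pi_quotient x)) (repr (\pi_quotient y)) hx hy => x' y' hx hy.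
apply/quotient_circP/asboolP.
have := ID _ _ (In (y^-1) _ hx) hy.
by rewrite invgM invgK !mulgA mulgK.
Qed.

Lemma pi_inv x : \pi_quotient (x^-1) = qinv (\pi_quotient x).
Proof.
rewrite /qmul /qinv; have [_ [[I0 ID IN] In] _] := idealP I.
have /quotient_circP/asboolP hx := pi_repr x.
move: (repr (\pi_quotient x)) hx => x' hx.
apply/quotient_circP/asboolP.
have := In x _ (IN _ hx).
by rewrite invgM !invgK !mulgA mulgK.
Qed.

Lemma qind (P : quotient -> Prop) :
  (forall x, P (\pi_quotient x)) -> forall u, P u.
Proof. by move=> h u; rewrite -[u]reprK. Qed.

Lemma qaddA : associative qadd.
Proof.
by elim/qind=> x; elim/qind=> y; elim/qind=> z; rewrite -!pi_add sbaddA.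
Qed.

Lemma qadd0l : left_id (\pi_quotient (0 : B)) qadd.
Proof. by elim/qind=> x; rewrite -pi_add sbadd0l. Qed.

Lemma qaddNl : left_inverse (\pi_quotient (0 : B)) qopp qadd.
Proof. by elim/qind=> x; rewrite -pi_opp -pi_add sbaddNl. Qed.

Lemma qmulA : associative qmul.
Proof.
by elim/qind=> x; elim/qind=> y; elim/qind=> z; rewrite -!pi_mul mulgA.
Qed.

Lemma qmul1l : left_id (\pi_quotient (1 : B)) qmul.
Proof. by elim/qind=> x; rewrite -pi_mul mul1g. Qed.

Lemma qmul1r : right_id (\pi_quotient (1 : B)) qmul.
Proof. by elim/qind=> x; rewrite -pi_mul mulg1. Qed.

Lemma qmulVl : left_inverse (\pi_quotient (1 : B)) qinv qmul.
Proof. by elim/qind=> x; rewrite -pi_inv -pi_mul mulVg. Qed.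

Lemma qmulVr : right_inverse (\pi_quotient (1 : B)) qinv qmul.
Proof. by elim/qind=> x; rewrite -pi_inv -pi_mul mulgV. Qed.

Lemma qdistr u v w :
  qmul u (qadd v w) = qadd (qadd (qmul u v) (qopp u)) (qmul u w).
Proof.
elim/qind: u => x; elim/qind: v => y; elim/qind: w => z.
by rewrite -pi_add -!pi_mul -pi_opp -!pi_add skew_distr.
Qed.

HB.instance Definition _ :=
  isGroup.Build quotient qmulA qmul1l qmul1r qmulVl qmulVr.
HB.instance Definition _ :=
  isSkewBrace.Build quotient qaddA qadd0l qaddNl qdistr.

End Quotient.

Definition quotient_image (B : skewBraceType) (J : set B) (I : ideal B) :
  set (quotient I) := [set \pi_(quotient I) x | x in J].
Arguments quotient_image {B} J I.

(* Only the terms I 0, ..., I n of the family are relevant. *)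
Definition annihilator_series (B : skewBraceType) (n : nat)
    (I : nat -> ideal B) :=
  [/\ I 0%N = [set 0] :> set B, I n = [set: B] :> set B
    & forall j, (j < n)%N ->
        I j `<=` I j.+1 /\
        quotient_image (I j.+1) (I j) `<=` Ann (quotient (I j))].

Definition annihilator_nilpotent (B : skewBraceType) :=
  exists (n : nat) (I : nat -> ideal B), annihilator_series n I.

Definition acc_sub_skew_brace (B : skewBraceType) :=
  forall A : nat -> set B,
    (forall n, sub_skew_brace (A n)) -> (forall n, A n `<=` A n.+1) ->
    exists N, forall n, (N <= n)%N -> A n = A N.

(* Main.v *)
From mathcomp Require Import all_boot.
From mathcomp Require Import boolp classical_sets cardinality.
Require Import Defs.

(* Let G_0 = B and let G_(k+1) be the additive subgroup generated by the
   elements x * b, b * x and [x, b] (x in G_k, b in B), where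
   a * b = lambda_a(b) - b and [x, b] is the additive commutator.  Each G_k is
   an ideal contained in I_(n-k), so G_n = 0.  Modulo G_(k+2) these maps,
   for x in G_k, are homomorphisms in each variable for a suitable choice of +
   or o, and they vanish when one of the variables is in G_(k+1).
   Hence if B (for both operations) and G_k are finitely generated modulo
   G_(k+1), then so is G_(k+1) modulo G_(k+2).  Thus (B, +) has a finite central
   series with finitely generated factors, so all its subgroups are finitely
   generated and it satisfies the ascending chain condition on subgroups. *)

Set Implicit Arguments.
Unset Strict Implicit.
Unset Printing Implicit Defensive.

Local Open Scope classical_set_scope.
Local Open Scope group_scope.

(** * Subgroups, relative finite generation, and groups with all subgroups finitely generated *)

Definition subgroup (G : groupType) (A : set G) :=
  [/\ A 1, forall x y, A x -> A y -> A (x * y) & forall x, A x -> A x^-1].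

(* [A] is generated by [N] together with finitely many elements of [A]; it is
   not required that [N] be contained in [A]. *)
Definition fg_over (G : groupType) (N A : set G) :=
  exists s : seq G, [set` s] `<=` A /\
    forall H, subgroup H -> N `<=` H -> [set` s] `<=` H -> A `<=` H.

Section Groups.
Variable G : groupType.
Implicit Types (A H M N : set G) (f x y : G).

Lemma subgroup1 : subgroup [set (1 : G)].
Proof.
by split=> [//|x y -> ->|x ->] /=; rewrite ?mulg1 ?invg1.
Qed.

Lemma subgroupT : subgroup [set: G].
Proof. by []. Qed.

Lemma subgroupI A H : subgroup A -> subgroup H -> subgroup (A `&` H).
Proof.
move=> [A1 AM AV] [H1 HM HV]; split=> // [x y [? ?] [? ?]|x [? ?]].
  by split; [apply: AM|apply: HM].
by split; [apply: AV|apply: HV].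
Qed.

Lemma subgroup_bigcap (F : set (set G)) :
  (forall A, F A -> subgroup A) -> subgroup (\bigcap_(A in F) A).
Proof.
move=> FS; split=> [A /FS[]//|x y xF yF A FA|x xF A FA].
  by have [_ + _] := FS _ FA; apply; [apply: xF|apply: yF].
by have [_ _] := FS _ FA; apply; apply: xF.
Qed.

Lemma subgroup_smallest A : subgroup (smallest (@subgroup G) A).
Proof. by apply: subgroup_bigcap => M []. Qed.

Lemma subgroupX A x n : subgroup A -> A x -> A (x ^+ n).
Proof.
case=> A1 AM _ Ax; elim: n => [|n IH]; first by rewrite expg0.
by rewrite expgS; apply: AM.
Qed.

Lemma fg_over_trans N M A :
  M `<=` A -> fg_over M A -> fg_over N M -> fg_over N A.
Proof.
move=> MA [s [sA sgen]] [t [tM tgen]]; exists (s ++ t); split.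
  by move=> x /=; rewrite mem_cat => /orP[/sA|/tM/MA].
move=> H Hs NH stH; apply: sgen => //.
  by apply: tgen => // x xt; apply: stH; rewrite /= mem_cat xt orbT.
by move=> x xs; apply: stH; rewrite /= mem_cat xs.
Qed.

(** If [M] is a subgroup, its intersections with subgroups [A] are exactly its own subgroups;
    generation over [set0] is absolute. *)
Definition noetherian M := forall A, subgroup A -> fg_over set0 (A `&` M).

Lemma noetherian1 : noetherian [set (1 : G)].
Proof. by move=> A _; exists [::]; split=> // H [H1 _ _] _ _ x [_ ->]. Qed.

Lemma noetherianS M A : subgroup A -> A `<=` M -> noetherian M -> noetherian A.
Proof.
move=> As AM Mn H Hs; have := Mn _ (subgroupI Hs As).
by rewrite -setIA (setIidl AM).
Qed.

(** * Cyclic and central extensions of noetherian groups, and the chain condition *)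

Section CyclicExtension.
Variables (M : set G) (f : G).
Hypotheses (Ms : subgroup M) (fM : forall x, M x -> M (f * x * f^-1))
  (fVM : forall x, M x -> M (f^-1 * x * f)).

(* [zpow p q] is the power of [f] with integer exponent [p - q]. *)
Let zpow p q := f ^+ p * f ^- q.

Let fXVC p q : f ^- q * f ^+ p = zpow p q.
Proof.
have c : commute f^-1 f by apply/commute_sym/commuteV/commute_refl.
by rewrite /zpow -expVgn; apply: commuteX2.
Qed.

Let zpowM p q p' q' : zpow p q * zpow p' q' = zpow (p + p') (q + q').
Proof.
rewrite /zpow mulgA -(mulgA (f ^+ p)) fXVC /zpow addnC expgnDr.
by rewrite [(q + q')%N]addnC expgnDr invgM !mulgA -!expgnDr [(p + p')%N]addnC.
Qed.

Let zpowV p q : (zpow p q)^-1 = zpow q p.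
Proof. by rewrite /zpow invgM invgK. Qed.

Let zpow_norm p q x : M x -> M (zpow p q * x * (zpow p q)^-1).
Proof.
have hp n y : M y -> M (f ^+ n * y * f ^- n).
  elim: n y => [|n IH] y My; first by rewrite expg0 invg1 mulg1 mul1g.
  rewrite expgS invgM !mulgA -(mulgA f) -(mulgA f).
  by apply: fM; apply: IH.
have hn n y : M y -> M (f ^- n * y * f ^+ n).
  elim: n y => [|n IH] y My; first by rewrite expg0 invg1 mulg1 mul1g.
  rewrite expgSr invgM !mulgA -(mulgA f^-1) -(mulgA f^-1).
  by apply: fVM; apply: IH.
by move=> /(hn q)/(hp p); rewrite /zpow invgM invgK !mulgA.
Qed.

(** [M'] is the product of [M] and the cyclic group of [f]. A subgroup of [M'] is generated by its
    intersection with [M] and at most one further element, of least positive exponent in [f]. *)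
Lemma noetherian_cyclic : noetherian M ->
  exists M', [/\ subgroup M', M `<=` M', M' f & noetherian M'].
Proof.
move=> Mn; have [M1 MM MV] := Ms.
exists [set x | exists p q, M (x * zpow p q)]; split.
- split.
  + by exists 0, 0; rewrite /zpow expg0 invg1 !mulg1.
  + move=> x y [p [q Mx]] [p' [q' My]]; exists (p' + p)%N, (q' + q)%N.
    have := MM _ _ Mx (zpow_norm q p My).
    rewrite (zpowV q p) -zpowM -(zpowV p q).
    by move: (zpow p q) (zpow p' q') => z z'; rewrite !mulgA mulgK.
  + move=> x [p [q Mx]]; exists q, p.
    have := MV _ (zpow_norm p q Mx); rewrite -(zpowV p q).
    by move: (zpow p q) => z; rewrite mulgA mulgK invgM.
- by move=> x Mx; exists 0, 0; rewrite /zpow expg0 invg1 !mulg1.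
- by exists 0, 1%N; rewrite /zpow expg0 mul1g expg1 mulgV.
move=> A As; have [A1 AM AV] := As; have [s [sAM sgen]] := Mn A As.
(* The positive [d] for which [A] meets the coset [M f^d]. *)
pose D := [pred d : nat | `[< (0 < d)%N /\ exists2 x, A x & M (x * f ^- d) >]].
(* Up to inversion, the exponent of [f] is a natural number. *)
have key x : A x -> (exists p q, M (x * zpow p q)) ->
    exists n, M (x * f ^- n) \/ M (x^-1 * f ^- n).
  move=> Ax [p [q Mx]]; have [pq|/ltnW qp] := leqP p q.
    exists (q - p)%N; left; rewrite expgnFr // invgM invgK.
    exact: Mx.
  exists (p - q)%N; right; rewrite expgnFr // -/(zpow _ _).
  have := MV _ (zpow_norm p q Mx).
  by move: (zpow p q) => z; rewrite mulgA mulgK invgM.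
(* If no such [d] exists, [A] meets [M'] only inside [M], and [s] suffices. *)
have [[d0 dD]|nD] := pselect (exists d, D d); last first.
  exists s; split.
    by move=> x /sAM[Ax Mx]; split=> //; exists 0, 0;
      rewrite /zpow expg0 invg1 !mulg1.
  move=> H Hs _ sH x [Ax /(key _ Ax)[n Mn']]; apply: (sgen H) => //; split=> //.
  have n0 : n = 0.
    case: n Mn' => // n Mn'; case: nD; exists n.+1; apply/asboolP; split=> //.
    by case: Mn' => ?; [exists x|exists x^-1 => //; exact: AV].
  by move: Mn'; rewrite n0 expg0 invg1 !mulg1 => -[|/MV]; rewrite ?invgK.
case: (ex_minnP (ex_intro _ d0 dD)) => d /asboolP[d_gt0 [g Ag Mg]] dmin.
have gX n : M (g ^+ n * f ^- (d * n)).
  elim: n => [|n IH]; first by rewrite muln0 !expg0 invg1 mulg1.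
  have := MM _ _ Mg (zpow_norm d 0 IH).
  rewrite /zpow expg0 invg1 mulg1 !mulgA mulgVK -expgS -mulgA -invgM.
  by rewrite -expgnDr mulnS addnC.
exists (g :: s); split.
  move=> x; rewrite /= inE => /orP[/eqP ->|/sAM[Ax Mx]]; split=> //.
    by exists 0, d; rewrite /zpow expg0 mul1g.
  by exists 0, 0; rewrite /zpow expg0 invg1 !mulg1.
move=> H Hs _ sH; have [H1 HM HV] := Hs.
have Hg : H g by apply: sH; rewrite /= inE eqxx.
(* Division of [n] by [d]: [g^-k x] lies in [A] and in [M f^(n mod d)], so minimality of [d] forces
   remainder 0 and puts [g^-k x] in [M]. *)
have pos x n : A x -> M (x * f ^- n) -> H x.
  move=> Ax Mx; set k := (n %/ d)%N.
  have Axg : A (g ^- k * x) by apply: AM => //; apply: AV; apply: subgroupX.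
  suff Mxg : M (g ^- k * x).
    have Hxg : H (g ^- k * x).
      by apply: (sgen H) => // y ys; apply: sH; rewrite /= inE ys orbT.
    by have := HM _ _ (subgroupX k Hs Hg) Hxg; rewrite mulVKg.
  have Mr : M (g ^- k * x * f ^- (n %% d)).
    have := zpow_norm 0 (d * k) (MM _ _ (MV _ (gX k)) Mx).
    rewrite zpowV invgM !mulgA /zpow expg0 mul1g invg1 mulg1 invgK mulVg mul1g.
    rewrite -(mulgA _ _ (f ^+ (d * k))) fXVC.
    have -> : zpow (d * k) n = zpow (d * k) (d * k) * zpow 0 (n %% d).
      by rewrite zpowM addn0 mulnC -divn_eq.
    by rewrite /zpow expg0 mulgV !mul1g.
  have : (n %% d)%N = 0.
    apply/eqP; apply: contraT; rewrite -lt0n => r_gt0.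
    have /dmin : D (n %% d)%N by apply/asboolP; split=> //; exists (g ^- k * x).
    by rewrite leqNgt ltn_mod d_gt0.
  by move=> r0; move: Mr; rewrite r0 expg0 invg1 mulg1.
move=> x [Ax /(key _ Ax)[n [/pos|/pos h]]]; first exact.
by rewrite -[x]invgK; apply: HV; apply: h; exact: AV.
Qed.

End CyclicExtension.

(** The generators of [A] are adjoined to [N] one at a time. Each intermediate subgroup contains
    [N], hence all commutators with elements of [A], so [A] normalizes it and each step is a cyclic
    extension. *)
Lemma noetherian_central N A : subgroup N -> subgroup A -> fg_over N A ->
  (forall f x, A f -> N (f * x * f^-1 * x^-1)) -> noetherian N -> noetherian A.
Proof.
move=> Ns As [s [sA sgen]] cNA Nn; have [_ _ AV] := As.
suff [M [Ms NM sM Mn]] : exists M,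
    [/\ subgroup M, N `<=` M, [set` s] `<=` M & noetherian M].
  by apply: noetherianS Mn => //; apply: sgen.
elim: s sA {sgen} => [|f s IH] sA; first by exists N; split.
have [|M [Ms NM sM Mn]] := IH.
  by move=> x xs; apply: sA; rewrite /= inE xs orbT.
have Af : A f by apply: sA; rewrite /= inE eqxx.
have normM g x : A g -> M x -> M (g * x * g^-1).
  have [_ MM _] := Ms => Ag Mx.
  by rewrite -[_ * g^-1](mulgVK x); apply: MM => //; apply/NM/cNA.
have [|x Mx|M' [M's MM' M'f M'n]] := @noetherian_cyclic M f Ms _ _ Mn.
- by move=> x; apply: normM.
- by rewrite -{2}[f]invgK; apply: normM => //; apply: AV.
exists M'; split=> //; first exact: subset_trans MM'.
by move=> x; rewrite /= inE => /orP[/eqP ->|/sM/MM'].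
Qed.

(** The union of the chain is a finitely generated subgroup, and some term contains all its
    generators. *)
Lemma noetherian_acc (A : nat -> set G) : noetherian [set: G] ->
  (forall n, subgroup (A n)) -> (forall n, A n `<=` A n.+1) ->
  exists k, forall n, (k <= n)%N -> A n = A k.
Proof.
move=> Gn As Ainc.
have Ale m n : (m <= n)%N -> A m `<=` A n.
  move=> /subnK <-; elim: (n - m)%N => [//|i IH].
  by rewrite addSn; apply: subset_trans (Ainc _).
pose U := \bigcup_n A n.
have Us : subgroup U.
  split; first by exists 0 => //; case: (As 0).
    move=> x y [m _ Ax] [n _ Ay]; exists (maxn m n) => //.
    have [_ AM _] := As (maxn m n).
    apply: AM; first by apply: Ale Ax; apply: leq_maxl.
    by apply: Ale Ay; apply: leq_maxr.
  by move=> x [m _ Ax]; exists m => //; case: (As m) => _ _; apply.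
have [s []] := Gn U Us; rewrite setIT => sU sgen.
have [k sk] : exists k, [set` s] `<=` A k.
  elim: s sU {sgen} => [|x s IH] sU; first by exists 0.
  have [|k sk] := IH; first by move=> y ys; apply: sU; rewrite /= inE ys orbT.
  have [|m _ Ax] := sU x; first by rewrite /= inE eqxx.
  exists (maxn m k) => y; rewrite /= inE => /orP[/eqP ->|/sk].
    by apply: Ale Ax; apply: leq_maxl.
  by apply: Ale; apply: leq_maxr.
exists k => n kn; apply/seteqP; split; last exact: Ale.
by apply: (@subset_trans _ U); [move=> x; exists n|apply: sgen].
Qed.

End Groups.

(** * Displacements of a group acting by automorphisms *)

Section Action.
Variables (G V : groupType) (act : G -> V -> V).
Hypotheses (act1 : forall v, act 1 v = v)
  (actM : forall g h v, act (g * h) v = act g (act h v))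
  (actD : forall g v w, act g (v * w) = act g v * act g w).

(** For the action [lambda] this is [lambda a b - b]; for conjugation it is the commutator. *)
Definition displacement g v := act g v * v^-1.

Variables (P : set G) (D C H : set V).
Hypotheses (Ps : subgroup P) (Ds : subgroup D) (Hs : subgroup H).
Hypotheses (dPD : forall g v, P g -> D v -> C (displacement g v))
  (dPC : forall g c, P g -> C c -> H (displacement g c))
  (HC : forall v c, C c -> H c -> H (v * c * v^-1)).

Let act_1 g : act g 1 = 1.
Proof. by apply: (mulgI (act g 1)); rewrite -actD !mulg1. Qed.

Let actV g v : act g v^-1 = (act g v)^-1.
Proof. by apply: (mulgI (act g v)); rewrite -actD !mulgV. Qed.

(** Writing [d] for the displacement, [d(g, v w) = d(g, v) (v d(g, w) v^-1)], and [HC] absorbs the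
    conjugation. *)
Lemma displacement_subgroupr g :
  P g -> subgroup [set v | D v /\ H (displacement g v)].
Proof.
move=> Pg; have [D1 DM DV] := Ds; have [H1 HM HV] := Hs.
split=> [|v w [Dv Hv] [Dw Hw]|v [Dv Hv]]; split=> //.
- by rewrite /displacement act_1 mulgV.
- exact: DM.
- have := HM _ _ Hv (HC v (dPD Pg Dw) Hw).
  by rewrite /displacement actD invgM !mulgA mulgVK.
- exact: DV.
have := HV _ (HC v^-1 (dPD Pg Dv) Hv).
by rewrite /displacement actV !invgM !invgK !mulgA mulVg mul1g.
Qed.

(** With [u = d(h, v)], one has [d(g h, v) = d(g, u) u d(g, v)], and [dPC] puts the first factor in
    [H]. *)
Lemma displacement_subgroupl v :
  D v -> subgroup [set g | P g /\ H (displacement g v)].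
Proof.
move=> Dv; have [P1 PM PV] := Ps; have [H1 HM HV] := Hs.
have dK g u : displacement g u * u = act g u by rewrite mulgVK.
split=> [|g h [Pg Hg] [Ph Hh]|g [Pg Hg]]; split=> //.
- by rewrite /displacement act1 mulgV.
- exact: PM.
- have := HM _ _ (HM _ _ (dPC Pg (dPD Ph Dv)) Hh) Hg.
  by rewrite dK /displacement mulgA -actD mulgVK actM.
- exact: PV.
(* For [u = d(g^-1, v)], [act g u] is the inverse of [d(g, v)], so [u] is recovered from [d(g, u)]
   and [d(g, v)]. *)
have Cu := dPD (PV _ Pg) Dv; set u := displacement _ _ in Cu *.
have := HM _ _ (HV _ (dPC Pg Cu)) (HV _ Hg).
have -> : (displacement g v)^-1 = act g u.
  by rewrite /u /displacement actD -actM mulgV act1 actV invgM invgK.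
by rewrite -(dK g u) mulgA mulVg mul1g.
Qed.

End Action.

(** Modulo [N], elements of [C] are central and fixed by [P], so the displacement is multiplicative
    in each variable and its values on pairs of generators suffice. *)
Lemma displacement_fg (G V : groupType) (act : G -> V -> V)
    (P NP : set G) (D ND C N : set V) :
  (forall v, act 1 v = v) ->
  (forall g h v, act (g * h) v = act g (act h v)) ->
  (forall g v w, act g (v * w) = act g v * act g w) ->
  subgroup P -> subgroup D -> NP `<=` P -> ND `<=` D ->
  (forall g v, P g -> D v -> C (displacement act g v)) ->
  (forall v c, C c -> N (v * c * v^-1 * c^-1)) ->
  (forall g c, P g -> C c -> N (displacement act g c)) ->
  (forall g v, NP g -> D v -> N (displacement act g v)) ->
  (forall g v, P g -> ND v -> N (displacement act g v)) ->
  fg_over NP P -> fg_over ND D ->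
  fg_over N [set displacement act g v | g in P & v in D].
Proof.
move=> act1 actM actD Ps Ds NP_P ND_D dPD NC dPC dNP dND.
move=> [s [sP Pgen]] [t [tD Dgen]].
exists [seq displacement act g v | g <- s, v <- t]; split.
  move=> _ /allpairsP[[g v] /= [gs vt ->]].
  by exists g; [apply: sP|exists v; [apply: tD|]].
move=> H Hs NH stH _ [g Pg [v Dv <-]].
have HC w c : C c -> H c -> H (w * c * w^-1).
  have [_ HM _] := Hs => Cc Hc.
  by rewrite -[_ * w^-1](mulgVK c); apply: HM => //; apply/NH/NC.
have dPC' h c : P h -> C c -> H (displacement act h c).
  by move=> Ph Cc; apply/NH/dPC.
(* First [v] runs over all of [D] with [x] a generator; afterwards [v] is fixed and [g] runs over
   [P]. *)
have sD x : x \in s -> D `<=` [set w | D w /\ H (displacement act x w)].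
  move=> xs; have Px := sP _ xs.
  apply: Dgen; first exact: displacement_subgroupr dPD HC _ Px.
    by move=> w Nw; split; [apply: ND_D|apply/NH/dND].
  move=> w wt; split; first exact: tD.
  by apply: stH; apply/allpairsP; exists (x, w).
have /(_ _ Pg)[] // : P `<=` [set x | P x /\ H (displacement act x v)].
apply: Pgen; first exact: displacement_subgroupl dPD dPC' _ Dv.
  by move=> x Nx; split; [apply: NP_P|apply/NH/dNP].
by move=> x xs; split; [apply: sP|case: (sD x xs v Dv)].
Qed.

Lemma fg_overU (G : groupType) (N A A' : set G) :
  fg_over N A -> fg_over N A' -> fg_over N (A `|` A').
Proof.
move=> [s [sA sgen]] [t [tA tgen]]; exists (s ++ t); split.
  by move=> x /=; rewrite mem_cat => /orP[/sA|/tA]; [left|right].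
move=> H Hs NH stH x [/sgen|/tgen]; apply=> // y ys; apply: stH.
  by rewrite /= mem_cat ys.
by rewrite /= mem_cat ys orbT.
Qed.

Lemma fg_over_smallest (G : groupType) (N A : set G) :
  fg_over N A -> fg_over N (smallest (@subgroup G) A).
Proof.
move=> [s [sA sgen]]; exists s; split.
  by apply: subset_trans sA _; apply: sub_smallest.
by move=> H Hs NH sH; apply: smallest_sub => //; apply: sgen.
Qed.

(** * The lower series [G_k] of a skew brace and its factors *)

Section LowerSeries.
Variable B : skewBraceType.
Implicit Types (C : set B) (a b x y z : B).

Local Notation V := (add_group B).
Local Notation "x + y" := (sbadd x y).
Local Notation "- x" := (sbopp x).
Local Notation "x - y" := (sbadd x (sbopp y)).

Definition add_conj (x v : V) : V := x * v * x^-1.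

(* Everything that must vanish for [C] to lie in the annihilator. *)
Definition defects C : set V :=
  [set displacement (@lambda B : B -> V -> V) x b | x in C & b in setT] `|`
  [set displacement (@lambda B : B -> V -> V) b x | b in setT & x in C] `|`
  [set displacement add_conj x b | x in C & b in setT].

(** The step from [G_k] to [G_(k+1)]. *)
Definition lower_next C : set B := smallest (@subgroup V) (defects C).

(* Equivalent to [C] being an ideal. *)
Definition stable C := @subgroup V C /\ defects C `<=` C.

Lemma defects_sub C C' : C `<=` C' -> defects C `<=` defects C'.
Proof.
move=> CC' _ [[[x Cx [b _ <-]]|[b _ [x Cx <-]]]|[x Cx [b _ <-]]].
- by left; left; exists x; [apply: CC'|exists b].
- by left; right; exists b => //; exists x; [apply: CC'|].
- by right; exists x; [apply: CC'|exists b].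
Qed.

Lemma defects_next C : defects C `<=` lower_next C.
Proof. exact: sub_smallest. Qed.

Lemma next_sub C : stable C -> lower_next C `<=` C.
Proof. by case=> Cs dC; apply: smallest_sub. Qed.

Lemma stable_next C : stable C -> stable (lower_next C).
Proof.
move=> Cst; split; first exact: subgroup_smallest.
exact: subset_trans (defects_sub (next_sub Cst)) (@defects_next C).
Qed.

Lemma stableT : stable setT.
Proof. by split; [apply: subgroupT|apply: subsetT]. Qed.

Lemma next_lambdal C x b : C x -> lower_next C (lambda x b - b).
Proof.
by move=> Cx; apply: defects_next; left; left; exists x => //; exists b.
Qed.

Lemma next_lambdar C b x : C x -> lower_next C (lambda b x - x).
Proof.
by move=> Cx; apply: defects_next; left; right; exists b => //; exists x.
Qed.

Lemma next_conjl C x b : C x -> lower_next C (x + b - x - b).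
Proof. by move=> Cx; apply: defects_next; right; exists x => //; exists b. Qed.

Lemma next_conjr C b x : C x -> lower_next C (b + x - b - x).
Proof.
have [_ _ CV] := subgroup_smallest (defects C).
move=> Cx; have /CV := next_conjl b Cx.
by rewrite -[_^-1]/(- _) !sboppD !sboppK !sbaddA.
Qed.

Lemma stable_conj C b x : stable C -> C x -> C (b + x - b).
Proof.
move=> Cst Cx; have [[_ CM _] _] := Cst.
rewrite -[_ - b](@mulgVK V x); apply: CM => //.
by apply: (next_sub Cst); apply: next_conjr.
Qed.

Lemma stable_lambda C b x : stable C -> C x -> C (lambda b x).
Proof.
move=> Cst Cx; have [[_ CM _] _] := Cst.
rewrite -[lambda _ _](@mulgVK V x); apply: CM => //.
by apply: (next_sub Cst); apply: next_lambdar.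
Qed.

(** This and the next two identities pass between the two operations through [lambda], so that
    closure under one gives closure under the other. *)
Lemma oppE x : - x = lambda x x^-1.
Proof. by rewrite /lambda mulgV circ1E sbadd0r. Qed.

Lemma invE x : x^-1 = - lambda x^-1 x.
Proof. by rewrite /lambda mulVg circ1E sbadd0r sboppK. Qed.

Lemma addE x y : x + y = x * lambda x^-1 y.
Proof. by rewrite circE -lambda_circ mulgV lambda1. Qed.

Lemma stable_circ C : stable C -> @subgroup B C.
Proof.
move=> Cst; have [[C1 CM CV] _] := Cst; split=> [|x y Cx Cy|x Cx].
- by rewrite circ1E.
- by rewrite circE; apply: CM => //; apply: stable_lambda.
by rewrite invE; apply: CV; apply: stable_lambda.
Qed.

(* On [C] both operations agree modulo [lower_next C]. *)
Lemma lambda_mod_next C x y : stable C -> C x ->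
  exists2 z, lower_next C z & lambda x y = y * z.
Proof.
move=> Cst Cx; have Nst := stable_next Cst.
(* Write [lambda x y = d + y] with [d] in [lower_next C], move [d] to the right of [y] by
   conjugation, then turn [+] into [o] with [addE]. *)
exists (lambda y^-1 (- y + (lambda x y - y) + y)).
  apply: (stable_lambda _ Nst); rewrite -{4}[y]sboppK.
  by apply: (stable_conj _ Nst); apply: next_lambdal.
rewrite -addE !sbaddA; apply/esym.
by rewrite sbaddNr sbadd0l -sbaddA sbaddNl sbadd0r.
Qed.

Lemma fg_over_circ C :
  stable C -> @fg_over V (lower_next C) C -> @fg_over B (lower_next C) C.
Proof.
move=> Cst [s [sC sgen]]; exists s; split=> // H Hs NH sH.
have Ccs := stable_circ Cst.
have [[C0 CD CN] _] := Cst; have [C1 CM CV] := Ccs.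
have [H1 HM HV] := Hs.
(* The intersection is an additive subgroup because, for [x] and [y] in it, [x + y] is [x o y o z]
   with [z] in [lower_next C]. *)
suff : C `<=` H `&` C by move=> h x /h[].
apply: sgen; last by move=> x xs; split; [apply: sH|apply: sC].
  split; first by split=> //; rewrite -[X in H X]circ1E.
    move=> x y [Hx Cx] [Hy Cy]; split; last exact: CD.
    have [z Nz e] := lambda_mod_next y Cst (CV _ Cx).
    rewrite -[_ * _]/(x + y) addE e.
    exact: (HM _ _ Hx (HM _ _ Hy (NH _ Nz))).
  move=> x [Hx Cx]; split; last exact: CN.
  have [z Nz e] := lambda_mod_next (x : B)^-1 Cst Cx.
  by rewrite -[_^-1]/(- x) oppE e; apply: HM; [apply: HV|apply: NH].
by move=> x Nx; split; [apply: NH|apply: next_sub Nx].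
Qed.

(** Each of the three families of defects is a set of displacements. The acting group is [(B, o)]
    for the two families from [lambda] and [(B, +)] for commutators, which is why generation is
    needed for both operations. *)
Lemma fg_next C : stable C ->
  @fg_over V (lower_next C) setT -> @fg_over B (lower_next C) setT ->
  @fg_over V (lower_next C) C ->
  @fg_over V (lower_next (lower_next C)) (lower_next C).
Proof.
move=> Cst BV BB CV; have [[Ns _] [Cs _]] := (stable_next Cst, Cst).
have NC := next_sub Cst.
have central b x : lower_next C x -> lower_next (lower_next C) (b + x - b - x).
  exact: next_conjr.
apply: fg_over_smallest; apply: fg_overU; first apply: fg_overU.
- apply: (@displacement_fg B V _ C (lower_next C) setT
    (lower_next C) (lower_next C)) => //.
  + exact: lambda1.
  + exact: lambda_circ.
  + exact: lambdaD.
  + exact: stable_circ.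
  + by move=> g v Cg _; apply: next_lambdal.
  + by move=> g c _ Nc; apply: next_lambdar.
  + by move=> g v Ng _; apply: next_lambdal.
  + by move=> g v _ Nv; apply: next_lambdar.
  + exact: fg_over_circ.
- apply: (@displacement_fg B V _ setT (lower_next C) C
    (lower_next C) (lower_next C)) => //.
  + exact: lambda1.
  + exact: lambda_circ.
  + exact: lambdaD.
  + by move=> g v _ Cv; apply: next_lambdar.
  + by move=> g c _ Nc; apply: next_lambdar.
  + by move=> g v Ng _; apply: next_lambdal.
  + by move=> g v _ Nv; apply: next_lambdar.
- apply: (@displacement_fg V V _ C (lower_next C) setT
    (lower_next C) (lower_next C)) => //.
  + by move=> v; rewrite /add_conj invg1 mulg1 mul1g.
  + by move=> g h v; rewrite /add_conj invgM !mulgA.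
  + by move=> g v w; rewrite /add_conj !mulgA mulgVK.
  + by move=> g v Cg _; apply: next_conjl.
  + by move=> g c _ Nc; apply: central.
  + by move=> g v Ng _; apply: next_conjl.
  + by move=> g v _ Nv; apply: central.
Qed.

(** An additive subgroup containing [G_1] is a sub skew brace, since [lambda x y] and [y] agree
    modulo [G_1]. *)
Lemma fg_over_next0 : finitely_generated B -> @fg_over V (lower_next setT) setT.
Proof.
move=> [S [/finite_seqP[s ->] Sgen]]; exists s; split=> // H Hs NH sH.
apply: contrapT => HT; apply: Sgen; exists H; split=> //.
split; first exact: Hs.
have [H0 HD HN] := Hs.
have Hl x y : H y -> H (lambda x y).
  move=> Hy; rewrite -[lambda _ _](@mulgVK V y); apply: HD => //.
  by apply: NH; apply: next_lambdal.
split=> [|x y Hx Hy|x Hx]; first by rewrite circ1E.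
  by rewrite circE; apply: HD => //; apply: Hl.
by rewrite invE; apply: HN; apply: Hl.
Qed.

Definition lower k := iter k lower_next setT.

Lemma stable_lower k : stable (lower k).
Proof. by elim: k => [|k IH]; [apply: stableT|apply: stable_next]. Qed.

(** The three claims are proved together: they give generators of [G_(k+1)] modulo [G_(k+2)], which
    are then added to those of [B]. *)
Lemma fg_lower k : finitely_generated B ->
  [/\ @fg_over V (lower k.+1) setT, @fg_over B (lower k.+1) setT
    & @fg_over V (lower k.+1) (lower k)].
Proof.
move=> Bfg; elim: k => [|k [BV BB kV]].
  have h := fg_over_next0 Bfg; split=> //.
  exact: fg_over_circ.
have h : @fg_over V (lower k.+2) (lower k.+1).
  by apply: fg_next => //; apply: stable_lower.
split=> //; first exact: fg_over_trans BV h.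
exact: fg_over_trans BB (fg_over_circ (stable_lower k.+1) h).
Qed.

(** Climbs from [G_(k+1)] to [G_k]: the factor is finitely generated and additively central. *)
Lemma noetherian_lower k : finitely_generated B ->
  @noetherian V (lower k) -> @noetherian V setT.
Proof.
move=> Bfg; elim: k => // k IH Nk; apply: IH.
have [_ _ kV] := fg_lower k Bfg.
have [[ks _] [Nks _]] := (stable_lower k, stable_lower k.+1).
apply: noetherian_central Nk => // f x fk.
exact: next_conjl.
Qed.

Lemma Ann_defects x b : Ann B x ->
  [/\ lambda x b - b = 0%B, lambda b x - x = 0%B & x + b - x - b = 0%B].
Proof.
move=> /(_ b)[xb bx cx]; rewrite /lambda; split.
- by rewrite xb bx sbaddA sbaddNl sbadd0l sbaddNr.
- by rewrite bx cx sbaddA sbaddNl sbadd0l sbaddNr.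
by rewrite cx -sbaddA -sboppD sbaddNr.
Qed.

End LowerSeries.

(** * Comparison with an annihilator series, and conclusion *)

Lemma ideal_subgroup (B : skewBraceType) (I : ideal B) :
  @subgroup (add_group B) I.
Proof. by case: (idealP I) => [[+ _] _ _]. Qed.

Lemma pi_ideal (B : skewBraceType) (I : ideal B) (x : B) :
  \pi_(quotient I)%qT x = \pi_(quotient I)%qT (0%B : B) -> ideal_set I x.
Proof.
move=> e; have [I0 _ IN] := ideal_subgroup I.
have /quotientP/asboolP := e; rewrite sbadd0r => /IN.
by rewrite -[_^-1]/(sbopp _) sboppK.
Qed.

(** The image of [C] in the quotient by [I] lies in the annihilator, where all defects vanish; hence
    the defects of [C] lie in [I]. *)
Lemma next_annihilator (B : skewBraceType) (I J : ideal B) (C : set B) :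
  quotient_image J I `<=` Ann (quotient I) -> C `<=` J -> lower_next C `<=` I.
Proof.
move=> JI CJ; have pC x : C x -> Ann (quotient I) (\pi_(quotient I)%qT x).
  by move=> Cx; apply: JI; exists x => //; apply: CJ.
apply: smallest_sub; first exact: ideal_subgroup.
move=> _ [[[x Cx [b _ <-]]|[b _ [x Cx <-]]]|[x Cx [b _ <-]]];
  have [h1 h2 h3] := Ann_defects (\pi_(quotient I)%qT b) (pC _ Cx);
  apply: pi_ideal.
- by rewrite -[RHS]h1 /displacement /lambda !(pi_add, pi_opp, pi_mul).
- by rewrite -[RHS]h2 /displacement /lambda !(pi_add, pi_opp, pi_mul).
rewrite -[RHS]h3.
rewrite -[displacement _ _ _]/(sbadd (sbadd (sbadd x b) (sbopp x)) (sbopp b)).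
by rewrite !(pi_add, pi_opp).
Qed.

Lemma lower_series_sub (B : skewBraceType) n (I : nat -> ideal B) k :
  annihilator_series n I -> (k <= n)%N -> lower k `<=` I (n - k)%N.
Proof.
move=> [I0 In Iann]; elim: k => [|k IH] kn; first by rewrite subn0 In.
have [|_ ann] := Iann (n - k.+1)%N.
  by rewrite ltn_subrL /= (leq_ltn_trans _ kn).
(* The index [(n - k.+1).+1] becomes [n - k], as in the induction hypothesis. *)
apply: next_annihilator ann _; rewrite -subSn // subSS.
by apply: IH; apply: ltnW.
Qed.

Theorem theorem3p3 (B : skewBraceType) :
  annihilator_nilpotent B -> finitely_generated B -> acc_sub_skew_brace B.
Proof.
move=> [n [I Iser]] Bfg A As Ainc.
(* Sub skew braces are additive subgroups, so the chain condition in [(B, +)] suffices. *)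
apply: (@noetherian_acc (add_group B)) => //; last by move=> k; have [] := As k.
apply: (noetherian_lower (k := n) Bfg).
(* The climb starts at [G_n], which lies in [I 0], the zero ideal. *)
apply: noetherianS (@noetherian1 _); first by have [] := @stable_lower B n.
have := lower_series_sub Iser (leqnn n); rewrite subnn.
by have [-> _ _] := Iser.
Qed.
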